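(* Let $T$ be a tree with maximum degree $\Delta\ge 3$ and $\ell$ leaves. Then the set of lengths of leaf-to-leaf paths in $T$ has at least $\log_{\Delta-1}((\Delta-2)\ell)$ elements.
   Context: A leaf is a vertex of degree $1$. A leaf-to-leaf path is a path both of whose endpoints are leaves; the length of a path is its number of edges, and a single vertex is considered a path of length $0$ (so every leaf gives a leaf-to-leaf path of length $0$). *)

(* Defs.v *)
From HB Require Import structures.
From mathcomp Require Import all_boot.

Set Implicit Arguments.
Unset Strict Implicit.
Unset Printing Implicit Defensive.

Section Graph.

Variables (V : finType) (e : rel V).

Record simple_graph : Prop := SimpleGraph {
  adj_sym : symmetric e;
  adj_irr : irreflexive e
}.

Definition degree (x : V) : nat := #|[set y | e x y]|.

Definition max_degree : nat := \max_(x : V) degree x.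

(* In a loopless graph a [ucycle] of size at most 2 is not a cycle: [[:: x; y]] *)
(* is one for every edge xy, traversed back and forth.                          *)
Definition acyclic : Prop := forall c : seq V, ucycle e c -> size c < 3.

Record is_tree : Prop := IsTree {
  tree_simple : simple_graph;
  tree_nonempty : 0 < #|V|;
  tree_connected : forall x y : V, connect e x y;
  tree_acyclic : acyclic
}.

Definition leaf (x : V) : bool := degree x == 1.

Definition leaves : {set V} := [set x | leaf x].

(* The path with vertex sequence [x :: p]; its length is [size p]. *)
Definition leaf_path (x : V) (p : seq V) : bool :=
  [&& path e x p, uniq (x :: p), leaf x & leaf (last x p)].

(* A path has at most #|V| vertices, hence length less than #|V|, so indexing  *)
(* by ['I_#|V|] loses nothing; see [leaf_path_lengthsP].                        *)
Definition leaf_path_lengths : {set 'I_#|V|} :=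
  [set k : 'I_#|V| | [exists x : V, exists p : k.-tuple V, leaf_path x p]].

Lemma leaf_path_lengthsP (k : nat) :
  (exists x p, leaf_path x p /\ size p = k) <->
  (exists2 i : 'I_#|V|, i \in leaf_path_lengths & i = k :> nat).
Proof.
split=> [[x [p [xp szp]]] | [i]].
  have ltkV : k < #|V|.
    case/and4P: (xp) => _ /card_uniqP sz _ _.
    by rewrite -szp -[(size p).+1]/(size (x :: p)) -sz max_card.
  exists (Ordinal ltkV) => //; rewrite inE; apply/existsP; exists x.
  by apply/existsP; exists (Tuple (introT eqP szp)).
rewrite inE => /existsP[x /existsP[p xp]] <-.
by exists x, p; rewrite size_tuple.
Qed.

End Graph.

(* Main.v *)
Require Import Defs.
From mathcomp Require Import all_boot all_order all_algebra.
From mathcomp Require Import reals exp.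
From mathcomp Require Import zify.

Set Implicit Arguments.
Unset Strict Implicit.
Unset Printing Implicit Defensive.

Import Order.TTheory GRing.Theory Num.Theory.

(** Let [q = Delta - 1] and let [U] be the set of lengths. Removing the centre of
    the tree (a vertex or an edge) leaves a forest in which every vertex has at
    most [q] children; there are at most [q + 1] trees, and two leaves at depths
    [i], [j] of different trees are at distance [i + j + delta], with [delta = 2] or
    [delta = 1] according to the kind of centre. The maximal depth [H] occurs
    in two trees, so [H + f + delta] is a length for every depth [f] of a leaf.
    Let level [e] be the set of leaves of depth [e], and let [w e] be 0, 1 or 2 if
    level [e] meets no, one or at least two trees. If [t] lengths are at most
    [2 e + delta], then level [e] has at most [(q ^ t - q ^ (t - w e)) / (q - 1)]
    leaves. On the other hand a nonempty level [e] forces at least [w f] lengths larger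
    than [2 e + delta] for every [f > e], all distinct: [H + f + delta] if level
    [f] is nonempty, and [e + f + delta] if it meets two trees. Hence
    [t + \sum_(f > e) w f <= #|U|], and the bounds on the levels telescope to
    [(q - 1) * l < q ^ #|U|]. *)

Lemma card_le_fibers (T T' : finType) (S : {set T}) (f : T -> T') (k N : nat) :
  #|f @: S| <= k -> (forall w, #|[set x in S | f x == w]| <= N) ->
  #|S| <= k * N.
Proof.
move=> lek leN; rewrite -sum1_card (partition_big_imset f) /=.
apply: leq_trans (leq_mul lek (leqnn N)); rewrite -sum_nat_const.
apply: leq_sum => w _; apply: leq_trans (leN w).
by rewrite sum1dep_card.
Qed.

(** * Counting leaves level by level in an abstract rooted forest *)

Section ForestCount.

Variables (V : finType) (par : V -> V) (h : V -> nat) (X : {set V}).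
Variables (delta q H : nat) (U : seq nat) (x0 z0 : V).

Let root x := iter (h x) par x.

Hypothesis q_gt0 : 0 < q.
Hypothesis delta_gt0 : 0 < delta.
Hypothesis U_uniq : uniq U.
Hypothesis U0 : 0 \in U.
Hypothesis U_same : forall b x y, x \in X -> y \in X -> h x = h y -> b < h x ->
  iter b par x != iter b par y -> iter b.+1 par x = iter b.+1 par y ->
  b.+1.*2 \in U.
Hypothesis U_cross : forall x y, x \in X -> y \in X -> root x != root y ->
  h x + h y + delta \in U.
Hypothesis card_children : forall b v,
  #|[set iter b par x | x in [set x in X | (b < h x) && (iter b.+1 par x == v)]]|
    <= q.
Hypothesis card_roots : #|[set root x | x in X]| <= q.+1.
Hypotheses (x0X : x0 \in X) (z0X : z0 \in X) (root_x0z0 : root x0 != root z0).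
Hypotheses (h_x0 : h x0 = H) (h_z0 : h z0 = H).
Hypothesis h_le : forall x, x \in X -> h x <= H.

Let below n := count (fun u => u <= n) U.

Lemma below_gt0 n : 0 < below n.
Proof. by rewrite /below -has_count; apply/hasP; exists 0. Qed.

Lemma below_le m n : m <= n -> below m <= below n.
Proof. by move=> le_mn; apply: sub_count => u /= /leq_trans; apply. Qed.

Lemma below_lt m n : n \in U -> m < n -> below m < below n.
Proof.
move=> nU lt_mn; rewrite /below -!size_filter.
apply: (@uniq_leq_size _ (n :: [seq u <- U | u <= m])).
  by rewrite /= filter_uniq // mem_filter leqNgt lt_mn.
move=> u; rewrite inE mem_filter => /predU1P[-> | /andP[le_um uU]].
  by rewrite mem_filter leqnn.
by rewrite mem_filter uU andbT; lia.
Qed.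

(* Inside one level the distances between leaves are ultrametric, and each value
   that occurs splits a ball into at most [q] smaller ones. *)
Lemma card_ball (S : {set V}) (b n : nat) (v : V) :
  {in S, forall x, [/\ x \in X, h x = n & iter b par x = v]} -> b <= n ->
  #|S| <= q ^ (below b.*2).-1.
Proof.
elim: b S v => [|b IHb] S v S_v le_bn.
  (* A ball of radius 0 is a single leaf. The length 0 is always counted by [below], which is why
     the exponent is a predecessor. *)
  apply: leq_trans (_ : 1 <= _); last by rewrite expn_gt0 q_gt0.
  apply/card_le1_eqP => x y /S_v[_ _ /= ->] /S_v[_ _ /= ->] //.
have S_w w : #|[set x in S | iter b par x == w]| <= q ^ (below b.*2).-1.
  apply: (IHb _ w); last exact: ltnW.
  by move=> x; rewrite inE => /andP[/S_v[? ? _] /eqP].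
have le_b : below b.*2 <= below b.+1.*2 by apply: below_le; lia.
have [S1|] := leqP #|[set iter b par x | x in S]| 1.
  apply: leq_trans (card_le_fibers S1 S_w) _.
  by rewrite mul1n leq_pexp2l //; lia.
case/card_gt1P => _ [_ [/imsetP[x xS ->] /imsetP[y yS ->] neq_xy]].
have [xX hx px] := S_v _ xS; have [yX hy py] := S_v _ yS.
have bU : b.+1.*2 \in U.
  by apply: (@U_same b x y) => //; rewrite ?px ?py // ?hx ?hy.
have ltb : below b.*2 < below b.+1.*2 by apply: (below_lt bU); rewrite ltn_double.
have Sq : #|[set iter b par x | x in S]| <= q.
  apply: leq_trans (card_children b v); apply/subset_leq_card/imsetS.
  by apply/subsetP => z /S_v[zX hz pz]; rewrite inE zX hz pz eqxx le_bn.
apply: leq_trans (card_le_fibers Sq S_w) _.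
rewrite -expnS leq_pexp2l //; have := below_gt0 b.*2; lia.
Qed.

Let level e := [set x in X | h x == e].
(* 0 for an empty level, 1 for a level inside one tree of the forest, 2 otherwise. *)
Let width e := minn #|[set root x | x in level e]| 2.

Lemma width_le2 e : width e <= 2. Proof. exact: geq_minr. Qed.

Lemma width_gt0 e : (0 < width e) = (level e != set0).
Proof.
by rewrite /width leq_min andbT card_gt0 imset_eq0. Qed.

Lemma width2P e : width e = 2 ->
  exists x y, [/\ x \in X, y \in X, h x = e, h y = e & root x != root y].
Proof.
move=> w2; have : 1 < #|[set root x | x in level e]|.
  by move: w2; rewrite /width; lia.
case/card_gt1P => _ [_ [/imsetP[x + ->] /imsetP[y + ->] neq_xy]].
by rewrite !inE => /andP[xX /eqP hx] /andP[yX /eqP hy]; exists x, y.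
Qed.

(** Makes the subtraction in the exponent of [card_level] genuine: 0 is always a length, and for
    width 2 so is the positive number [e.*2 + delta]. *)
Lemma width_le_below e : level e != set0 -> width e <= below (e.*2 + delta).
Proof.
move=> e_n0; have [|w2] := leqP (width e) 1.
  by move/leq_trans; apply; apply: below_gt0.
have {}w2 : width e = 2 by have := width_le2 e; lia.
have [x [y [xX yX hx hy neq]]] := width2P w2.
have := U_cross xX yX neq; rewrite hx hy addnn w2 => /below_lt lt.
by apply: leq_ltn_trans (lt 0 _); [apply: below_gt0 | lia].
Qed.

(** Each tree meets the level in a ball of radius [e], so [card_ball] applies. Width 1 means one
    ball. For width 2 there are at most [q + 1] balls, and [e.*2 + delta] is a length beyond [e.*2];
    with [t] lengths up to it the level has at most [(q + 1) * q ^ (t - 2)] leaves, and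
    [(q - 1) * (q + 1) = q ^ 2 - 1]. *)
Lemma card_level e : level e != set0 ->
  q.-1 * #|level e| + q ^ (below (e.*2 + delta) - width e)
    <= q ^ below (e.*2 + delta).
Proof.
move=> e_n0; have w_le := width_le_below e_n0.
have S_w w : #|[set x in level e | root x == w]| <= q ^ (below e.*2).-1.
  apply: (@card_ball _ e e w) => // x.
  by rewrite !inE -andbA /root => /and3P[xX /eqP hx /eqP]; rewrite hx.
have w_gt0 : 0 < width e by rewrite width_gt0.
have le_b : below e.*2 <= below (e.*2 + delta) by apply: below_le; lia.
have b_gt0 := below_gt0 e.*2.
have [w1|w2] := leqP (width e) 1.
  have {}w1 : width e = 1 by lia.
  have le1 : #|[set root x | x in level e]| <= 1.
    by move: w1; rewrite /width; lia.
  have := card_le_fibers le1 S_w; rewrite mul1n w1 => le_l.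
  have {}le_l : #|level e| <= q ^ (below (e.*2 + delta)).-1.
    by apply: leq_trans le_l _; rewrite leq_pexp2l //; lia.
  rewrite -[X in _ <= q ^ X]prednK 1?expnS; last by lia.
  rewrite subn1 -[X in _ <= X * _](prednK q_gt0) mulSn addnC leq_add2l.
  by rewrite leq_mul2l le_l orbT.
have {}w2 : width e = 2 by have := width_le2 e; lia.
have [x [y [xX yX hx hy neq]]] := width2P w2.
have eU := U_cross xX yX neq; rewrite hx hy addnn in eU.
have lt : below e.*2 < below (e.*2 + delta).
  by apply: (below_lt eU); rewrite -[X in X < _]addn0 ltn_add2l.
have leq1 : #|[set root x | x in level e]| <= q.+1.
  apply: leq_trans card_roots; apply/subset_leq_card/imsetS.
  by apply/subsetP => z; rewrite inE => /andP[].
have le_l := card_le_fibers leq1 S_w.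
rewrite w2; set t := below (_ + _) in lt le_b *.
have {}le_l : #|level e| <= q.+1 * q ^ (t - 2).
  apply: leq_trans le_l _; rewrite leq_mul2l leq_pexp2l ?orbT //; lia.
have -> : q ^ t = q * q * q ^ (t - 2).
  by rewrite -mulnA -!expnS; congr (_ ^ _); lia.
have: q.-1 * #|level e| <= q.-1 * (q.+1 * q ^ (t - 2)) by rewrite leq_mul2l le_l orbT.
move: (q ^ _) => N; move: q_gt0; case: (q) => // r _ /=; nia.
Qed.

Let above e := \sum_(e.+1 <= f < H.+1) width f.

(* The lengths [H + f + delta], for the occupied levels [f > e], and [e + f + delta],
   for the levels [f > e] that meet two trees, are pairwise distinct. *)
Lemma above_le e : level e != set0 ->
  below (e.*2 + delta) + above e <= size U.
Proof.
case/set0Pn => x; rewrite inE => /andP[xX /eqP hx].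
pose W := [seq f <- index_iota e.+1 H.+1 | 0 < width f].
pose B := [seq f <- index_iota e.+1 H.+1 | width f == 2].
pose E := [seq H + f + delta | f <- W] ++ [seq e + f + delta | f <- B].
have memW f : f \in W -> [/\ e < f, f <= H & level f != set0].
  by rewrite mem_filter mem_index_iota width_gt0 => /andP[-> /andP[-> ?]].
have memB f : f \in B -> [/\ e < f, f <= H & width f = 2].
  by rewrite mem_filter mem_index_iota => /andP[/eqP-> /andP[-> ?]].
have uniqE : uniq E.
  rewrite cat_uniq !map_inj_uniq ?filter_uniq ?iota_uniq //=; try by move=> ? ?; lia.
  (* The two lists are disjoint: [H + g] exceeds [e + f] as soon as [e < g] and [f <= H]. *)
  rewrite andbT; apply/hasPn => _ /mapP[f /memB[ltef lefH _] ->].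
  by apply/mapP => -[g /memW[lteg legH _]]; lia.
have subE : {subset E <= [seq u <- U | e.*2 + delta < u]}.
  move=> u; rewrite mem_filter mem_cat => /orP[] /mapP[f].
    case/memW => ltef lefH /set0Pn[y]; rewrite inE => /andP[yX /eqP hy] ->.
    apply/andP; split; first by lia.
    (* One of the deepest leaves [x0], [z0] lies in another tree than [y]. *)
    have [eq|ne] := eqVneq (root x0) (root y).
      by rewrite -h_z0 -hy U_cross // -eq eq_sym.
    by rewrite -h_x0 -hy U_cross.
  case/memB => ltef lefH /width2P[y [z [yX zX hy hz neq]]] ->.
  apply/andP; split; first by lia.
  have [eq|ne] := eqVneq (root x) (root y); last by rewrite -hx -hy U_cross.
  by rewrite -hx -hz U_cross // eq.
have sizeE : size E = above e.
  rewrite size_cat !size_map !size_filter /above.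
  elim: (index_iota _ _) => [|f s IHs]; first by rewrite big_nil.
  rewrite big_cons /= -IHs; by case: (width f) (width_le2 f) => [|[|[|]]] //= _; lia.
rewrite -sizeE -(count_predC (fun u => u <= e.*2 + delta) U) leq_add2l.
rewrite -size_filter; apply: leq_trans (uniq_leq_size uniqE subE) _.
by rewrite !size_filter; apply: sub_count => u /=; lia.
Qed.

Lemma card_levels e : e <= H.+1 ->
  q.-1 * #|[set x in X | e <= h x]| + q ^ (size U - \sum_(e <= f < H.+1) width f)
    <= q ^ size U.
Proof.
(* Descending induction on the level, starting above the deepest one, where no leaf remains. *)
move=> leeH; rewrite -(subKn leeH); move: (H.+1 - e) => k; clear e leeH.
elim: k => [|k IHk].
  rewrite subn0 big_geq // subn0 (_ : [set x in X | _] = set0) ?cards0 ?muln0 //.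
  apply/setP => x; rewrite !inE; apply/negP => /andP[/h_le]; lia.
have [lekH|ltHk] := leqP k H; last first.
  by move: IHk; rewrite (_ : H.+1 - k = H.+1 - k.+1) //; lia.
move: IHk; rewrite (_ : H.+1 - k = (H.+1 - k.+1).+1); last by lia.
have : H.+1 - k.+1 < H.+1 by lia.
move: (H.+1 - k.+1) => {lekH k} e lteH IHe.
have -> : [set x in X | e <= h x] = level e :|: [set x in X | e < h x].
  by apply/setP => x; rewrite !inE -andb_orr leq_eqVlt eq_sym.
rewrite cardsU (_ : _ :&: _ = set0) ?cards0 ?subn0; last first.
  by apply/setP => x; rewrite !inE; lia.
rewrite big_ltn // -/(above e); rewrite -/(above e) in IHe.
have [e0|e_n0] := eqVneq (level e) set0.
  have : width e = 0 by apply/eqP; rewrite -leqn0 leqNgt width_gt0 e0 eqxx.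
  by rewrite e0 cards0 add0n => ->.
have := card_level e_n0; have := above_le e_n0; have := width_le_below e_n0.
set t := below _; move: (width e) (above e) IHe => w p IHe lewt letp le_l.
rewrite mulnDr addnAC; apply: leq_trans IHe; rewrite addnC leq_add2l.
(* The bound of [card_level], multiplied by [q ^ (size U - p - t)], is exactly the next term of the
   telescoping sum; [above_le] gives [t + p <= size U]. *)
have -> : size U - (w + p) = t - w + (size U - p - t) by lia.
have eqU : size U - p = t + (size U - p - t) by lia.
rewrite [X in _ <= q ^ X]eqU {eqU}.
move: (size U - p - t) => k; rewrite !expnD.
have k_gt0 : 0 < q ^ k by rewrite expn_gt0 q_gt0.
apply: leq_trans (_ : (q.-1 * #|level e| + q ^ (t - w)) * q ^ k <= _).
  by rewrite mulnDl leq_add2r leq_pmulr.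
by rewrite leq_mul2r le_l orbT.
Qed.

Lemma card_forest : q.-1 * #|X| < q ^ size U.
Proof.
have := card_levels (leq0n H.+1).
have -> : [set x in X | 0 <= h x] = X by apply/setP => x; rewrite inE andbT.
apply: leq_trans; rewrite -addn1 leq_add2l expn_gt0 q_gt0 //.
Qed.

End ForestCount.

(** * Rooting a tree: parents, depths and joins of ancestor lines *)

(* [par c] is a junk value. *)
Record rooted (V : finType) (e : rel V) (c : V) (par : V -> V) (dep : V -> nat) : Prop :=
  Rooted {
    dep_eq0 : forall v, (dep v == 0) = (v == c);
    adj_par : forall v, 0 < dep v -> e v (par v);
    dep_par : forall v, 0 < dep v -> dep (par v) = (dep v).-1
  }.

(** Breadth-first search: the depth is the distance to [c], and a parent is any neighbour one step
    closer. *)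
Lemma exists_rooted (V : finType) (e : rel V) (c : V) :
  (forall x y, connect e x y) -> exists par dep, rooted e c par dep.
Proof.
move=> conn.
pose P v n := [exists p : n.-tuple V, path e v p && (last v p == c)].
have exP v : exists n, P v n.
  have /connectP[p vp lp] := conn v c.
  by exists (size p); apply/existsP; exists (in_tuple p); rewrite vp -lp /=.
pose dep v := ex_minn (exP v).
have depP v p : path e v p -> last v p = c -> dep v <= size p.
  move=> vp lp; rewrite /dep; case: ex_minnP => m _; apply.
  by apply/existsP; exists (in_tuple p); rewrite vp /= lp eqxx.
have dep_ex v : exists p, [/\ path e v p, last v p = c & size p = dep v].
  rewrite /dep; case: ex_minnP => m /existsP[p /andP[vp /eqP lp]] _.
  by exists p; rewrite size_tuple.
pose par v := odflt v [pick u | e v u && (dep v == (dep u).+1)].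
have parP v : 0 < dep v -> e v (par v) /\ dep v = (dep (par v)).+1.
  move=> dep_gt0; rewrite /par; case: pickP => [u /andP[vu /eqP]//|].
  have [[|u p] [/= vp lp sp]] := dep_ex v; first by rewrite -sp in dep_gt0.
  case/andP: vp => vu up /(_ u) /negbT; rewrite vu /= => /negP[].
  rewrite eqn_leq -{2}sp ltnS (depP u p) // andbT.
  have [r [ur lr <-]] := dep_ex u.
  by rewrite -[(size r).+1]/(size (u :: r)); apply: depP; rewrite //= vu.
exists par, dep; split=> [v|v /parP[]//|v /parP[_ ->]//].
apply/idP/eqP => [/eqP dv|->]; last by rewrite -leqn0 (depP c [::]).
by have [[|u p] [_ //= _]] := dep_ex v; rewrite dv.
Qed.

Section Rooted.

Variables (V : finType) (e : rel V) (c : V) (par : V -> V) (dep : V -> nat).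
Hypothesis e_sym : symmetric e.
Hypothesis rt : rooted e c par dep.

Lemma dep_root : dep c = 0.
Proof. by apply/eqP; rewrite (dep_eq0 rt). Qed.

Lemma dep_iter i v : i <= dep v -> dep (iter i par v) = dep v - i.
Proof.
elim: i => [|i IHi] le_i; first by rewrite subn0.
by rewrite iterS (dep_par rt) IHi; lia.
Qed.

Lemma iter_dep v : iter (dep v) par v = c.
Proof. by apply/eqP; rewrite -(dep_eq0 rt) dep_iter ?subnn. Qed.

Lemma path_traject_par i v : i <= dep v -> path e v (traject par (par v) i).
Proof.
elim: i v => //= i IHi v lt_i.
rewrite (adj_par rt) ?IHi ?(dep_par rt) //; lia.
Qed.

Lemma uniq_traject_par i v : i <= (dep v).+1 -> uniq (traject par v i).
Proof.
move=> le_i; apply/(uniqP v) => j k; rewrite !inE size_traject => ltji ltki.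
rewrite !nth_traject // => eq_jk.
have := congr1 dep eq_jk; rewrite !dep_iter; lia.
Qed.

Lemma join_path x y i j : i <= dep x -> j <= dep y ->
  iter i par x = iter j par y ->
  (forall i' j', i = i'.+1 -> j = j'.+1 -> iter i' par x != iter j' par y) ->
  exists p, [/\ path e x p, uniq (x :: p), last x p = y & size p = i + j].
Proof.
move=> le_i le_j eq_ij neq_ij.
have dep_ij : dep x - i = dep y - j by rewrite -!dep_iter // eq_ij.
exists (traject par (par x) i ++ rev (traject par y j)); split.
- rewrite cat_path path_traject_par // last_traject eq_ij -last_traject.
  suff -> : traject par y j = belast y (traject par (par y) j).
    rewrite rev_path (eq_path (e' := e)) ?path_traject_par //.
  have := trajectSr par y j; rewrite trajectS lastI => /rcons_inj.
  by rewrite last_traject => -[->].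
- rewrite -cat_cons -trajectS cat_uniq rev_uniq !uniq_traject_par ?andbT //=; last first.
    exact: leqW.
  apply/hasPn => v; rewrite mem_rev => /trajectP[b lt_bj ->].
  rewrite -trajectS; apply/negP => /trajectP[a lt_ai eq_ab].
  (* A vertex common to both halves has the same depth seen from either side, so the two ancestor
     lines would already agree one step below the join. *)
  have eq_k : i - a = j - b by have := congr1 dep eq_ab; rewrite !dep_iter; lia.
  have := neq_ij i.-1 j.-1; rewrite !prednK; try lia.
  move/(_ erefl erefl)/eqP; apply.
  have -> : i.-1 = (j - b).-1 + a by lia.
  have -> : j.-1 = (j - b).-1 + b by lia.
  by rewrite !iterD eq_ab.
- rewrite last_cat last_traject; case: j {neq_ij le_j dep_ij} eq_ij => [|j] //= _.
  by rewrite rev_cons last_rcons.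
- by rewrite size_cat size_rev !size_traject.
Qed.

(** Take the lowest ancestor of [x] that is also an ancestor of [y]; the root [c] is a candidate. *)
Lemma exists_join x y : exists i j, [/\ i <= dep x, j <= dep y,
  iter i par x = iter j par y &
  forall i' j', i = i'.+1 -> j = j'.+1 -> iter i' par x != iter j' par y].
Proof.
pose P i := (i <= dep x) && [exists j : 'I_(dep y).+1, iter i par x == iter j par y].
have exP : exists i, P i.
  exists (dep x); rewrite /P leqnn; apply/existsP; exists ord_max.
  by rewrite !iter_dep.
case: (ex_minnP exP) => i /andP[le_i /existsP[j /eqP eq_ij]] min_i.
exists i, j; split=> //; first by rewrite -ltnS.
move=> i' j' def_i def_j; apply/eqP => eq_ij'.
suff /min_i : P i' by rewrite def_i ltnn.
have lt_j : j' < (dep y).+1 by rewrite ltnW // -def_j.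
rewrite /P -ltnS -def_i leqW //=; apply/existsP; exists (Ordinal lt_j).
by rewrite /= eq_ij'.
Qed.

(** The edge closes the join path into a cycle, so the path has at most two vertices. All uses of
    acyclicity go through this lemma. *)
Lemma adj_parP u v : irreflexive e -> acyclic e -> e u v ->
  (0 < dep u /\ v = par u) \/ (0 < dep v /\ u = par v).
Proof.
move=> e_irr e_acyc uv; have [i [j [le_i le_j eq_ij neq_ij]]] := exists_join u v.
have [p [up p_uniq lp sp]] := join_path le_i le_j eq_ij neq_ij.
have : size (u :: p) < 3.
  by apply: e_acyc; rewrite /ucycle p_uniq /= rcons_path up lp e_sym uv.
rewrite /= sp => lt_ij.
move: i j le_i le_j eq_ij {neq_ij sp} lt_ij => [|[|i]] [|[|j]] //=; try lia.
- by move=> _ _ eq_uv; rewrite eq_uv e_irr in uv.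
- by move=> _ ? ->; right.
- by move=> ? _ <-; left.
Qed.

Lemma join_lengths x y i j : leaf e x -> leaf e y -> i <= dep x -> j <= dep y ->
  iter i par x = iter j par y ->
  (forall i' j', i = i'.+1 -> j = j'.+1 -> iter i' par x != iter j' par y) ->
  i + j \in [seq val k | k <- enum (leaf_path_lengths e)].
Proof.
move=> xl yl le_i le_j eq_ij neq_ij.
have [p [xp p_uniq lp sp]] := join_path le_i le_j eq_ij neq_ij.
have [|k kL <-] := (leaf_path_lengthsP e (i + j)).1.
  by exists x, p; split=> //; rewrite /leaf_path xp p_uniq xl lp.
by apply: map_f; rewrite mem_enum.
Qed.

(** The child of [c] whose subtree contains [v]; for [v = c] it is [c] itself. *)
Definition branch v := iter (dep v).-1 par v.

Lemma dep_branch v : 0 < dep v -> dep (branch v) = 1.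
Proof. by move=> ?; rewrite dep_iter; lia. Qed.

Lemma par_branch v : 0 < dep v -> par (branch v) = c.
Proof. by move=> ?; rewrite /branch -iterS prednK ?iter_dep. Qed.

Lemma adj_branch v : 0 < dep v -> e c (branch v).
Proof.
move=> dv; rewrite e_sym -[X in e _ X](par_branch dv).
by rewrite (adj_par rt) // dep_branch.
Qed.

Lemma branch_par v : 0 < dep (par v) -> 0 < dep v -> branch (par v) = branch v.
Proof.
move=> dp dv; rewrite /branch (dep_par rt) // -iterSr prednK //.
by rewrite -(dep_par rt).
Qed.

Lemma branch_dep1 v : dep v = 1 -> branch v = v.
Proof. by rewrite /branch => ->. Qed.

End Rooted.

Lemma leaf1P (V : finType) (e : rel V) (z w : V) :
  e z w -> (forall y, e z y -> y = w) -> leaf e z.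
Proof.
move=> zw zP; apply/cards1P; exists w; apply/setP => y; rewrite !inE.
by apply/idP/eqP => [/zP|->].
Qed.

(** Moving the root along the edge from [c] to [b] brings the subtree of [b] one step closer and
    pushes everything else one step away; this is how the centre is approached. *)
Lemma rooted_reroot (V : finType) (e : rel V) (c : V) (par : V -> V)
    (dep : V -> nat) (b : V) :
  symmetric e -> rooted e c par dep -> dep b = 1 ->
  rooted e b (fun v => if v == c then b else par v)
    (fun v => if (0 < dep v) && (branch par dep v == b)
              then (dep v).-1 else (dep v).+1).
Proof.
move=> e_sym rt dep_b; have dep_c := dep_root rt.
have c_b : e c b by have := adj_branch e_sym rt (v := b); rewrite branch_dep1 dep_b // => ->.
split=> v.
- have [/andP[dv /eqP bv]|] := ifPn; last first.
    by move=> nb; apply/esym; apply: contraNF nb => /eqP ->; rewrite branch_dep1 ?dep_b ?eqxx.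
  apply/eqP/eqP => [dv1|->]; last by rewrite dep_b.
  by rewrite -bv branch_dep1 //; lia.
- have [->|neq_vc] := eqVneq v c; first by rewrite c_b.
  by rewrite (adj_par rt) // lt0n (dep_eq0 rt).
have [->|neq_vc] := eqVneq v c.
  by rewrite dep_c dep_b (@branch_dep1 _ _ _ b) // eqxx.
have dv : 0 < dep v by rewrite lt0n (dep_eq0 rt).
rewrite dv /=; have [/eqP bv|nbv] := ifPn.
  move=> dv2; have dp : 0 < dep (par v) by rewrite (dep_par rt).
  by rewrite dp (branch_par rt) // bv eqxx (dep_par rt).
rewrite (_ : _ && _ = false) ?(dep_par rt) ?prednK //.
apply/negP => /andP[dp]; rewrite -(dep_par rt) // in dp *.
by rewrite (branch_par rt) // (negbTE nbv).
Qed.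

(** * Finding the centre and applying the forest bound *)

Section LeafCount.

Variables (V : finType) (e : rel V) (q : nat).
Hypothesis e_sym : symmetric e.
Hypothesis e_irr : irreflexive e.
Hypothesis e_acyclic : acyclic e.
Hypothesis degree_le : forall v, degree e v <= q.+1.
Hypothesis q_gt0 : 0 < q.
Variables u0 v0 : V.
Hypothesis u0v0 : e u0 v0.

Let U := [seq val k | k <- enum (leaf_path_lengths e)].

Lemma uniq_lengths : uniq U.
Proof. by rewrite map_inj_uniq ?enum_uniq //; apply: val_inj. Qed.

Lemma card_nbrs_le (S : {set V}) (v w : V) :
  {in S, forall y, e v y} -> w \notin S -> e v w -> #|S| <= q.
Proof.
move=> Sv wS vw; rewrite -ltnS -[#|S|.+1]/(1 + #|S|).
have -> : 1 = (w \notin S) by rewrite wS.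
rewrite -cardsU1; apply: leq_trans (degree_le v); apply: subset_leq_card.
by apply/subsetP => y; rewrite !inE => /predU1P[->|/Sv].
Qed.

Section Core.

Variables (c : V) (par : V -> V) (dep : V -> nat).
Hypothesis rt : rooted e c par dep.
(* The forest of the vertices below the centre: [off] marks the vertices whose
   root is a child of [c], the other ones being rooted at [c] itself. *)
Variables (off : pred V) (delta H : nat) (x0 z0 : V).
Let h v := dep v - off v.
Let root v := iter (h v) par v.
Hypothesis off_gt0 : forall v, off v -> 0 < dep v.
Hypothesis delta_gt0 : 0 < delta.
Hypothesis U_cross : forall x y, leaf e x -> leaf e y -> root x != root y ->
  h x + h y + delta \in U.
(** Other vertices have a parent, which leaves at most [q] children; [c] has none, so its bound
    depends on the kind of centre. *)
Hypothesis root_children : forall b,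
  #|[set iter b par x | x in [set x in leaves e | (b < h x) && (iter b.+1 par x == c)]]|
    <= q.
Hypothesis card_roots : #|[set root x | x in leaves e]| <= q.+1.
Hypotheses (x0_leaf : leaf e x0) (z0_leaf : leaf e z0).
Hypotheses (root_x0z0 : root x0 != root z0) (h_x0 : h x0 = H) (h_z0 : h z0 = H).
Hypothesis h_le : forall x, h x <= H.

Lemma card_leaves_forest : q.-1 * #|leaves e| < q ^ #|leaf_path_lengths e|.
Proof.
have -> : #|leaf_path_lengths e| = size U by rewrite size_map -cardE.
have h_dep v : h v <= dep v by apply: leq_subr.
apply: (@card_forest V par h (leaves e) delta q H U x0 z0); rewrite ?inE //.
- exact: uniq_lengths.
- by apply: (join_lengths (i := 0) (j := 0) e_sym rt x0_leaf x0_leaf).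
- move=> b x y; rewrite !inE => xl yl hxy lt_b neq eq_xy.
  have ltx : b < dep x by apply: leq_trans (h_dep x).
  have lty : b < dep y by apply: leq_trans (h_dep y); rewrite -hxy.
  rewrite -addnn; apply: (join_lengths e_sym rt xl yl) => //.
  by move=> _ _ [<-] [<-].
- by move=> x y; rewrite !inE; apply: U_cross.
- move=> b v; have [->|neq_vc] := eqVneq v c; first exact: root_children.
  have dv : 0 < dep v by rewrite lt0n (dep_eq0 rt).
  apply: (@card_nbrs_le _ v (par v)); last exact: (adj_par rt).
    move=> _ /imsetP[x + ->]; rewrite !inE => /and3P[_ lt_b /eqP <-].
    rewrite iterS e_sym (adj_par rt) // (dep_iter rt); have := h_dep x; lia.
  apply/imsetP => -[x]; rewrite !inE => /and3P[_ lt_b /eqP eq_v] eq_p.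
  have := congr1 dep eq_p; rewrite (dep_par rt) // -eq_v !(dep_iter rt); have := h_dep x; lia.
Qed.

End Core.

Lemma leaf_bottom (c : V) (par : V -> V) (dep : V -> nat) (z : V) :
  rooted e c par dep -> 0 < dep z -> (forall w, dep w = (dep z).+1 -> par w != z) ->
  leaf e z.
Proof.
move=> rt dz bot; apply: (leaf1P (w := par z)); first exact: (adj_par rt).
move=> y zy; have [[]//|[dy eq_zy]] := adj_parP e_sym rt e_irr e_acyclic zy.
have := bot y; rewrite -eq_zy eqxx => /(_ _)/negP[] //.
by rewrite {1}eq_zy (dep_par rt) // prednK.
Qed.

Lemma card_leaves_vertex_center (c : V) (par : V -> V) (dep : V -> nat) (n : nat) (x z : V) :
  rooted e c par dep -> (forall v, dep v <= n.+1) -> dep x = n.+1 -> dep z = n.+1 ->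
  branch par dep x != branch par dep z ->
  q.-1 * #|leaves e| < q ^ #|leaf_path_lengths e|.
Proof.
move=> rt dep_le dx dz neq.
have hE v : dep v - (0 < dep v) = (dep v).-1 by lia.
have bottom v : dep v = n.+1 -> leaf e v.
  move=> dv; apply: (leaf_bottom rt); rewrite ?dv // => w dw.
  by have := dep_le w; rewrite dw ltnn.
(* The centre has neighbours in two distinct branches, so it is not a leaf. *)
have dep_leaf v : leaf e v -> 0 < dep v.
  move=> vl; rewrite lt0n (dep_eq0 rt); apply: contraNneq neq => eq_vc.
  move: vl; rewrite eq_vc => /cards1P[w wP].
  have nbr y : 0 < dep y -> branch par dep y = w.
    by move/(adj_branch e_sym rt) => cy; apply/set1P; rewrite -wP inE.
  by rewrite !nbr ?dx ?dz.
have br_nbr v : leaf e v -> e c (branch par dep v).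
  by move/dep_leaf/(adj_branch e_sym rt).
apply: (@card_leaves_forest c par dep rt (fun v => 0 < dep v) 2 n x z) => //=;
  rewrite ?hE ?dx ?dz ?bottom //.
- move=> u v ul vl; rewrite !hE => neq_uv.
  have [du dv] := (dep_leaf _ ul, dep_leaf _ vl).
  have -> : (dep u).-1 + (dep v).-1 + 2 = dep u + dep v by lia.
  apply: (join_lengths e_sym rt ul vl) => //; first by rewrite !(iter_dep rt).
  by move=> i j def_i def_j; move: neq_uv; rewrite def_i def_j.
- move=> b; rewrite (_ : imset _ _ = set0) ?cards0 //.
  apply/setP => w; rewrite inE; apply/negP => /imsetP[v].
  rewrite !inE hE => /and3P[_ lt_b /eqP/(congr1 dep)].
  rewrite (dep_root rt) -?iterS (dep_iter rt) => [|]; lia.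
- apply: leq_trans (degree_le c); apply: subset_leq_card; apply/subsetP => w.
  by case/imsetP => v; rewrite !inE hE => /br_nbr ? ->.
- by move: neq; rewrite /branch dx dz.
- by move=> v; rewrite hE; have := dep_le v; lia.
Qed.

(** Cutting the edge between [c] and [b] leaves one tree rooted at each end, both of height [n];
    crossing that edge accounts for [delta = 1]. *)
Lemma card_leaves_edge_center (c : V) (par : V -> V) (dep : V -> nat) (n : nat) (x z : V) :
  let in_b v := (0 < dep v) && (branch par dep v == branch par dep x) in
  rooted e c par dep -> (forall v, dep v <= n.+1) -> dep x = n.+1 ->
  (forall v, dep v = n.+1 -> in_b v) -> dep z = n -> ~~ in_b z ->
  q.-1 * #|leaves e| < q ^ #|leaf_path_lengths e|.
Proof.
set b := branch par dep x => in_b rt dep_le dx deep_b dz zNb.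
have dx_gt0 : 0 < dep x by rewrite dx.
have db : dep b = 1 by rewrite (dep_branch rt).
have cb : e c b by apply: (adj_branch e_sym rt).
have neq_bc : b != c by rewrite -(dep_eq0 rt) db.
have xl : leaf e x.
  by apply: (leaf_bottom rt) => // w; have := dep_le w; lia.
have zl : leaf e z.
  (* If [n = 0] then [z] is [c], whose neighbours have depth 1, hence lie in the branch of [b] and
     equal [b]. *)
  have [z0|dz_gt0] := posnP (dep z).
    have eq_zc : z = c by apply/eqP; rewrite -(dep_eq0 rt) z0.
    rewrite eq_zc; apply: (leaf1P cb) => y cy.
    have [[]|[dy eq_cy]] := adj_parP e_sym rt e_irr e_acyclic cy.
      by rewrite (dep_root rt).
    have dy1 : dep y = 1.
      by have := dep_par rt dy; rewrite -eq_cy (dep_root rt); lia.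
    have /deep_b/andP[_ /eqP <-] : dep y = n.+1 by rewrite dy1 -dz z0.
    by rewrite branch_dep1.
  apply: (leaf_bottom rt) => // w dw; apply: contraNneq zNb => eq_wz.
  have /deep_b/andP[dw_gt0 bw] : dep w = n.+1 by rewrite dw dz.
  by rewrite /in_b dz_gt0 -{1}eq_wz (branch_par rt) ?eq_wz // bw.
have rootE v : iter (dep v - in_b v) par v = if in_b v then b else c.
  have [/andP[dv /eqP <-]|_] := ifP; first by rewrite subn1.
  by rewrite subn0 (iter_dep rt).
have b_neq_c u v : in_b u -> ~~ in_b v -> leaf e u -> leaf e v ->
    dep u + dep v \in U.
  move=> /andP[du /eqP bu] vb ul vl.
  apply: (join_lengths e_sym rt ul vl) => //; first by rewrite !(iter_dep rt).
  move=> i j def_i def_j; apply: contraNneq vb => eq_uv.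
  by rewrite /in_b def_j /= /branch def_j /= -eq_uv -bu /branch def_i.
apply: (@card_leaves_forest c par dep rt in_b 1 n x z) => //=; rewrite ?rootE.
- move=> u v ul vl; rewrite !rootE.
  have [ub|ub] := ifPn; have [vb|vb] := ifPn; rewrite ?eqxx // => _.
    have -> : dep u - true + (dep v - false) + 1 = dep u + dep v.
      by case/andP: ub; lia.
    exact: b_neq_c.
  have -> : dep u - false + (dep v - true) + 1 = dep v + dep u.
    by case/andP: vb; lia.
  exact: b_neq_c.
(* In the tree rooted at [c], the neighbour [b] takes the place of the missing parent. *)
- move=> k; apply: (@card_nbrs_le _ c b) => //.
    move=> _ /imsetP[v + ->]; rewrite !inE => /and3P[_ lt_k /eqP <-].
    rewrite e_sym (adj_par rt) // (dep_iter rt); lia.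
  apply/imsetP => -[v]; rewrite !inE => /and3P[_ lt_k /eqP eq_c] eq_b.
  have dv : dep v = k.+1.
    by move/(congr1 dep): eq_c; rewrite (dep_root rt) -iterS (dep_iter rt) => [|]; lia.
  move: lt_k; rewrite /in_b /branch dv /= -eq_b eqxx; lia.
- apply: (@leq_trans #|[set b; c]|); last by rewrite cards2 neq_bc.
  apply: subset_leq_card; apply/subsetP => w /imsetP[v _ ->].
  by rewrite rootE !inE; case: ifP; rewrite eqxx ?orbT.
- by rewrite deep_b // (negbTE zNb).
- by rewrite deep_b // dx subn1.
- by rewrite (negbTE zNb) subn0.
- move=> v; have [/deep_b -> | ?] := eqVneq (dep v) n.+1; have := dep_le v; lia.
Qed.

(** Induction on the height. If two branches reach the full height, [c] is the centre; if only one
    does and some vertex outside it is one level higher, the centre is an edge; otherwise rerooting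
    in the deepest branch lowers the height. *)
Lemma card_leaves (n : nat) (c : V) (par : V -> V) (dep : V -> nat) :
  rooted e c par dep -> (forall v, dep v <= n) ->
  q.-1 * #|leaves e| < q ^ #|leaf_path_lengths e|.
Proof.
elim: n c par dep => [|n IHn] c par dep rt dep_le.
  have all_c v : v = c by apply/eqP; rewrite -(dep_eq0 rt) -leqn0.
  by move: u0v0; rewrite (all_c u0) (all_c v0) e_irr.
have [x /eqP dx|no_x] := pickP (fun x => dep x == n.+1); last first.
  apply: (IHn c par dep rt) => v; have := dep_le v; have := no_x v; lia.
pose in_b v := (0 < dep v) && (branch par dep v == branch par dep x).
have [/existsP[z /andP[/eqP dz neq]]|] :=
    boolP [exists z, (dep z == n.+1) && (branch par dep x != branch par dep z)].
  exact: (card_leaves_vertex_center rt dep_le dx dz neq).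
rewrite negb_exists => /forallP one_b.
have deep_b v : dep v = n.+1 -> in_b v.
  by move=> dv; have := one_b v; rewrite /in_b dv eqxx /= negbK eq_sym.
have [/existsP[z /andP[/eqP dz zNb]]|] :=
    boolP [exists z, (dep z == n) && ~~ in_b z].
  exact: (card_leaves_edge_center rt dep_le dx deep_b dz zNb).
rewrite negb_exists => /forallP no_z.
have db : dep (branch par dep x) = 1 by rewrite (dep_branch rt) ?dx.
apply: IHn (rooted_reroot e_sym rt db) _ => v; rewrite -/(in_b v).
have := dep_le v; have [|vNb] := ifPn; first by lia.
have := no_z v; rewrite vNb andbT => dvn.
have : dep v != n.+1 by apply: contraNneq vNb => /deep_b.
lia.
Qed.

End LeafCount.

(** * From the integer inequality to logarithms *)

Local Open Scope ring_scope.

Theorem theorem1p4 (R : realType) (V : finType) (e : rel V) (Delta l : nat)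
    (e_tree : is_tree e) (e_Delta : max_degree e = Delta)
    (Delta_ge3 : (3 <= Delta)%N) (e_leaves : #|leaves e| = l) :
  ln ((Delta%:R - 2) * l%:R : R) / ln (Delta%:R - 1 : R)
    <= #|leaf_path_lengths e|%:R.
Proof.
have [[e_sym e_irr] V_gt0 e_conn e_acyc] := e_tree.
have [u max_u] := bigop.eq_bigmax (degree e) V_gt0.
have [v uv] : exists v, e u v.
  have /card_gt0P[v] : (0 < degree e u)%N.
    by rewrite -max_u -/(max_degree e) e_Delta; apply: leq_trans Delta_ge3.
  by rewrite inE => uv; exists v.
have [par [dep rt]] := exists_rooted u e_conn.
have bound : ((Delta - 2) * l < (Delta - 1) ^ #|leaf_path_lengths e|)%N.
  have -> : (Delta - 2 = (Delta - 1).-1)%N by lia.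
  rewrite -e_leaves.
  apply: (@card_leaves _ _ _ e_sym e_irr e_acyc _ _ u v uv (\max_x dep x) u par dep) => //.
  - move=> x; apply: (@leq_trans Delta); last by lia.
    by rewrite -e_Delta; apply: (bigop.leq_bigmax x).
  - by lia.
  - by move=> x; apply: (bigop.leq_bigmax x).
have DR2 : Delta%:R - 2 = (Delta - 2)%:R :> R by rewrite natrB //; lia.
have DR1 : Delta%:R - 1 = (Delta - 1)%:R :> R by rewrite natrB //; lia.
rewrite DR1 DR2 -natrM.
have lnq_gt0 : 0 < ln (Delta - 1)%:R :> R by rewrite ln_gt0 // ltr1n; lia.
rewrite ler_pdivrMr // mulr_natl -lnXn; last by rewrite ltr0n; lia.
(* For a zero product, [ln] takes its default value 0 and the bound is trivial. *)
have [->|n_gt0] := posnP ((Delta - 2) * l)%N.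
  by rewrite ln0 // ln_ge0 // exprn_ege1 // ler1n; lia.
by rewrite -natrX ler_ln ?posrE ?ltr0n ?ler_nat ?(ltnW bound) // expn_gt0; lia.
Qed.
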